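(* Let $R=\mathbb C[x_1,\ldots,x_m]$, let $D_1,\ldots,D_k\in R$, and let $I=\langle D_1,\ldots,D_k\rangle$ have an irredundant primary decomposition $I=I_1\cap\cdots\cap I_n$ (primary ideals with pairwise distinct radicals, none redundant). Put $J_i=I_1\cap\cdots\cap I_i$. Suppose that (1) $\dim\mathcal Z(I_i)=m-k$ for each $i=1,\ldots,n$, and (2) $J_i+I_{i+1}$ is a radical ideal for each $i=1,\ldots,n-1$. Then for every choice of polynomial-valued $(m-k-1)$-forms $\alpha_1,\ldots,\alpha_n$ there exists a polynomial-valued $(m-1)$-form $\omega$ such that $$[\omega]_i=[\alpha_i\wedge dD_1\wedge\cdots\wedge dD_k]_i\qquad\text{for all } i=1,\ldots,n,$$ i.e. every coefficient of $\omega-\alpha_i\wedge dD_1\wedge\cdots\wedge dD_k$ lies in $I_i$, for each $i$.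
   Context: $\mathcal Z(I_i)\subset\mathbb C^m$ is the zero locus of $I_i$ (a branch of the cut solution $\mathcal Z(I)$). A polynomial-valued differential form on $\mathbb C^m$ has polynomial coefficients in the standard basis $dx_{j_1}\wedge\cdots\wedge dx_{j_r}$. For an ideal $I_i$ and forms $\beta,\gamma$ of the same rank, $[\beta]_i=[\gamma]_i$ means that every coefficient of $\beta-\gamma$ in the standard basis lies in $I_i$. An ideal $J$ is radical if $J=\sqrt J$. *)

(* Defs.v *)
From mathcomp Require Import all_boot all_order all_algebra.
From mathcomp Require Import Rstruct.
From mathcomp Require Import complex.
From mathcomp Require Export mpoly.

Set Implicit Arguments.
Unset Strict Implicit.
Unset Printing Implicit Defensive.

Import Order.TTheory GRing.Theory.
Local Open Scope ring_scope.

Definition CC : closedFieldType := complex Rdefinitions.R.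

Notation Cpoly m := {mpoly CC[m]}.

Definition is_ideal m (S : Cpoly m -> Prop) : Prop :=
  S 0 /\ (forall a b, S a -> S b -> S (a + b)) /\ (forall r a, S a -> S (r * a)).

Definition gen_ideal m k (D : 'I_k -> Cpoly m) : Cpoly m -> Prop :=
  fun p => exists c : 'I_k -> Cpoly m, p = \sum_(i < k) c i * D i.

Definition radical m (S : Cpoly m -> Prop) : Cpoly m -> Prop :=
  fun p => exists e : nat, S (p ^+ e).

(* J is radical : J = sqrt J (J ⊆ sqrt J always holds with e = 1). *)
Definition is_radical_ideal m (S : Cpoly m -> Prop) : Prop :=
  is_ideal S /\ forall p, radical S p -> S p.

Definition is_primary m (Q : Cpoly m -> Prop) : Prop :=
  is_ideal Q /\ ~ Q 1 /\
  forall a b, Q (a * b) -> ~ Q a -> exists e : nat, Q (b ^+ e).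

Definition ideal_sum m (S T : Cpoly m -> Prop) : Cpoly m -> Prop :=
  fun p => exists a b, S a /\ T b /\ p = a + b.

(* J_i = I_0 ∩ ... ∩ I_i  (0-based indexing of the components). *)
Definition Jcap m (I : nat -> Cpoly m -> Prop) (i : nat) : Cpoly m -> Prop :=
  fun p => forall j, (j <= i)%N -> I j p.

Definition irredundant_primary_decomposition m (I : Cpoly m -> Prop)
    (Ii : nat -> Cpoly m -> Prop) (n : nat) : Prop :=
  (forall p, I p <-> (forall i, (i < n)%N -> Ii i p)) /\
  (forall i, (i < n)%N -> is_primary (Ii i)) /\
  (forall i j, (i < n)%N -> (j < n)%N -> i <> j ->
     ~ (forall p, radical (Ii i) p <-> radical (Ii j) p)) /\
  (forall j, (j < n)%N ->
     ~ (forall p, (forall i, (i < n)%N -> i <> j -> Ii i p) -> I p)).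

Definition point m := 'I_m -> CC.

Definition zero_locus m (S : Cpoly m -> Prop) : point m -> Prop :=
  fun x => forall p, S p -> p.@[x] = 0.

Definition zariski_closed m (A : point m -> Prop) : Prop :=
  exists S : Cpoly m -> Prop, forall x, A x <-> zero_locus S x.

Definition irreducible_closed m (A : point m -> Prop) : Prop :=
  zariski_closed A /\ (exists x, A x) /\
  forall B C : point m -> Prop, zariski_closed B -> zariski_closed C ->
    (forall x, A x -> B x \/ C x) ->
    (forall x, A x -> B x) \/ (forall x, A x -> C x).

Definition has_irred_chain m (A : point m -> Prop) (d : nat) : Prop :=
  exists Z : nat -> point m -> Prop,
    (forall i, (i <= d)%N -> irreducible_closed (Z i) /\ (forall x, Z i x -> A x)) /\
    (forall i, (i < d)%N ->
       (forall x, Z i x -> Z i.+1 x) /\ (exists x, Z i.+1 x /\ ~ Z i x)).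

Definition variety_dim m (A : point m -> Prop) (d : nat) : Prop :=
  has_irred_chain A d /\ ~ has_irred_chain A d.+1.

(* A form is given by its coefficients on dx_K, K ⊆ {x_1..x_m} listed
   increasingly; an r-form has nonzero coefficients only for #|K| = r. *)
Definition dform m := {set 'I_m} -> Cpoly m.

Definition form_of_rank m (r : nat) (w : dform m) : Prop :=
  forall K : {set 'I_m}, #|K| <> r -> w K = 0.

(* sign of dx_I ∧ dx_J -> dx_(I ∪ J) : (-1)^(number of inversions). *)
Definition wedge_sign m (I J : {set 'I_m}) : Cpoly m :=
  (-1) ^+ #|[set ij : 'I_m * 'I_m | (ij.1 \in I) && (ij.2 \in J) &&
                                      (nat_of_ord ij.2 < nat_of_ord ij.1)%N]|.

Definition wedge m (a b : dform m) : dform m :=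
  fun K => \sum_(I : {set 'I_m}) \sum_(J : {set 'I_m} |
              (I :|: J == K) && [disjoint I & J])
              wedge_sign I J * a I * b J.

Definition dpoly m (D : Cpoly m) : dform m :=
  fun K => \sum_(j : 'I_m) (if K == [set j] then mderiv j D else 0).

Definition wedge_dD m k (a : dform m) (D : 'I_k -> Cpoly m) : dform m :=
  foldl (fun acc i => wedge acc (dpoly (D i))) a (enum 'I_k).

(* Main.v *)
(* At a point x lying on two components, the Jacobian of D cannot have full rank k.
   If it had, there would be vector fields annihilating every D_i and spanning the
   kernel of the Jacobian at x. For any t the saturation (D) : t^oo is stable under
   them; Euler's formula shows that a stable ideal contained in the maximal ideal
   of x lies in (D) + m_x^n for all n, hence locally in (D) by Krull's theorem. So
   (D) is locally primary at x, which contradicts irredundancy.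
   Consequently dD_1 /\ ... /\ dD_k, and with it every alpha_i /\ dD_1 /\ ... /\ dD_k,
   vanishes wherever two components meet; by the Nullstellensatz the obstruction to
   gluing these forms lies in the radical of J_i + I_{i+1}, which is J_i + I_{i+1}. *)
Require Import Defs.
From mathcomp Require Import all_boot all_order all_algebra.
From mathcomp Require Import mpoly complex Rstruct ring boolp.
From Stdlib Require Reals.
From Stdlib Require Import Lra.

Set Implicit Arguments.
Unset Strict Implicit.
Unset Printing Implicit Defensive.

Import Order.TTheory GRing.Theory.
Local Open Scope ring_scope.

(** * Ideals and the ascending chain condition *)

Section Ideals.
Variables (m : nat) (S : Cpoly m -> Prop).
Hypothesis idS : is_ideal S.

Lemma ideal0 : S 0. Proof. by case: idS. Qed.
Lemma idealD a b : S a -> S b -> S (a + b).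
Proof. by case: idS => _ [h _]; apply: h. Qed.
Lemma idealMl r a : S a -> S (r * a).
Proof. by case: idS => _ [_ h]; apply: h. Qed.
Lemma idealMr r a : S a -> S (a * r).
Proof. by rewrite mulrC; apply: idealMl. Qed.
Lemma idealN a : S a -> S (- a).
Proof. by rewrite -mulN1r; apply: idealMl. Qed.
Lemma idealB a b : S a -> S b -> S (a - b).
Proof. by move=> Sa Sb; apply: idealD => //; apply: idealN. Qed.
Lemma ideal_bigsum (J : finType) (P : pred J) (f : J -> Cpoly m) :
  (forall j, P j -> S (f j)) -> S (\sum_(j | P j) f j).
Proof.
move=> h; elim/big_rec: _ => [|j x Pj Sx]; first exact: ideal0.
by apply: idealD => //; apply: h.
Qed.

End Ideals.

Lemma gen_ideal_is_ideal m k (D : 'I_k -> Cpoly m) : is_ideal (gen_ideal D).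
Proof.
split; first by exists (fun=> 0); rewrite big1 // => i _; rewrite mul0r.
split=> [_ _ [c ->] [d ->]|r _ [c ->]].
  by exists (fun i => c i + d i); rewrite -big_split; apply: eq_bigr => i _; rewrite mulrDl.
by exists (fun i => r * c i); rewrite mulr_sumr; apply: eq_bigr => i _; rewrite mulrA.
Qed.

Lemma gen_ideal_mem m k (D : 'I_k -> Cpoly m) i : gen_ideal D (D i).
Proof.
exists (fun j => (i == j)%:R); rewrite (bigD1 i) //= eqxx mul1r big1 ?addr0 //.
by move=> j; rewrite eq_sym => /negPf ->; rewrite mul0r.
Qed.

Lemma gen_ideal_sub m k (D : 'I_k -> Cpoly m) (S : Cpoly m -> Prop) :
  is_ideal S -> (forall i, S (D i)) -> forall p, gen_ideal D p -> S p.
Proof.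
move=> idS h _ [c ->]; apply: ideal_bigsum => // i _; exact: idealMl.
Qed.

Lemma argmin_tail (u : nat -> nat) N :
  exists2 n, (N <= n)%N & forall p, (N <= p)%N -> (u n <= u p)%N.
Proof.
have ex : exists v, `[< exists2 n, (N <= n)%N & u n = v >].
  by exists (u N); apply/asboolP; exists N.
case: (ex_minnP ex) => v /asboolP[n Nn <-] hmin; exists n => // p Np.
by apply: hmin; apply/asboolP; exists p.
Qed.

(** Each index is chosen where [u] attains its minimum on the tail beyond the previous index, and
    the next index lies in that same tail. *)
Lemma nondecreasing_subseq (u : nat -> nat) :
  exists2 phi : nat -> nat, {homo phi : i j / (i < j)%N} &
    {homo (fun i => u (phi i)) : i j / (i <= j)%N}.
Proof.
have /choice[nxt hnxt] (N : nat) : exists n, (N <= n)%N /\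
    forall p, (N <= p)%N -> (u n <= u p)%N.
  by have [n] := argmin_tail u N; exists n.
pose phi := fix phi n := if n is n'.+1 then nxt (phi n').+1 else nxt 0.
have phiS i : (phi i < phi i.+1)%N by apply: (hnxt _).1.
have phi_lt : {homo phi : i j / (i < j)%N} by apply: homo_ltn => //; apply: ltn_trans.
exists phi => //; apply: homo_leq => // [i|]; last first.
  by case=> [|i]; apply: (hnxt _).2 => //; apply: leq_trans (phiS i) (ltnW (phiS i.+1)).
by move=> j k l; apply: leq_trans.
Qed.

(** Subsequences are extracted for one coordinate after another; coordinates already made monotone
    stay so. *)
Lemma dickson m (s : nat -> 'X_{1..m}) : exists i j, (i < j)%N /\ (s i <= s j)%MM.
Proof.
suff [phi phi_lt hphi] : exists2 phi : nat -> nat, {homo phi : i j / (i < j)%N} &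
    forall c, c \in enum 'I_m -> {homo (fun i => s (phi i) c) : i j / (i <= j)%N}.
  exists (phi 0%N), (phi 1%N); split; first exact: phi_lt.
  by apply/mnm_lepP => c; apply: (hphi c) => //; rewrite mem_enum.
elim: (enum 'I_m) => [|c l [phi phi_lt hphi]]; first by exists id.
have [psi psi_lt hpsi] := nondecreasing_subseq (fun i => s (phi i) c).
exists (phi \o psi) => [i j ij|d]; first by apply: phi_lt; apply: psi_lt.
rewrite inE => /predU1P dcl i j ij /=.
case: dcl => [->|dl]; first exact: hpsi.
apply: hphi => //; move: ij; rewrite leq_eqVlt => /orP[/eqP -> //|ij].
by apply: ltnW; apply: psi_lt.
Qed.

Lemma exists_min_mlead m (P : Cpoly m -> Prop) :
  (exists p, P p) -> exists2 p, P p & forall q, P q -> (mlead p <= mlead q)%O.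
Proof.
case=> p0 Pp0; have: exists2 p, P p & mlead p = mlead p0 by exists p0.
elim/(well_founded_ind (@ltom_wf m)): (mlead p0) => M IH [p Pp pM].
have [[q Pq qp]|h] := pselect (exists2 q, P q & (mlead q < mlead p)%O).
  by apply: (IH (mlead q)); [rewrite -pM|exists q].
exists p => // q Pq; rewrite leNgt; apply/negP => qp; apply: h; by exists q.
Qed.

(* Replacing each [f n] by a representative of minimal leading monomial modulo
   the previous ones makes the leading monomials an antichain in Dickson's sense. *)
Lemma noetherian m (f : nat -> Cpoly m) :
  exists n, gen_ideal (fun i : 'I_n => f i) (f n).
Proof.
apply: contrapT => hno; pose G n := gen_ideal (fun i : 'I_n => f i).
have idG n : is_ideal (G n) by apply: gen_ideal_is_ideal.
have Gmono i j p : (i <= j)%N -> G i p -> G j p.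
  move=> ij; apply: gen_ideal_sub => // l.
  by have := gen_ideal_mem (fun i : 'I_j => f i) (widen_ord ij l).
have /choice[h hP] (n : nat) : exists hn, G n (f n - hn) /\
    forall q, G n (f n - q) -> (mlead hn <= mlead q)%O.
  have [|p] := @exists_min_mlead m (fun q => G n (f n - q)); last by exists p.
  by exists (f n); rewrite subrr; apply: ideal0.
have hn0 n : h n != 0.
  by apply/eqP => h0; apply: hno; exists n; have := (hP n).1; rewrite h0 subr0.
have [i [j [ij le_ij]]] := dickson (fun n => mlead (h n)).
have Ghi : G j (h i).
  apply: (Gmono i.+1) => //.
  have -> : h i = f i - (f i - h i) by rewrite opprB addrC subrK.
  apply: idealB => //; first exact: gen_ideal_mem (fun i0 : 'I_i.+1 => f i0) ord_max.
  by apply: (Gmono i) => //; case: (hP i).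
(* [t] is the multiple of [h i] with the leading term of [h j]. As [h i] lies in [G j], [h j - t]
   also represents [f j], with a smaller leading monomial unless it is zero, which would put [f j]
   in [G j]. *)
pose c := (h j)@_(mlead (h j)) / (h i)@_(mlead (h i)).
pose t := c *: 'X_[mlead (h j) - mlead (h i)] * h i.
have := (hP j).2 (h j - t).
have ci0 : (h i)@_(mlead (h i)) != 0 by rewrite mleadc_eq0.
have tE : t = c *: (h i * 'X_[mlead (h j) - mlead (h i)]) by rewrite /t -scalerAl mulrC.
have tj : t@_(mlead (h j)) = (h j)@_(mlead (h j)).
  rewrite tE mcoeffZ.
  have := mcoeffMX (h i) (mlead (h j) - mlead (h i)) (mlead (h i)).
  by rewrite submK // => ->; rewrite /c divfK.
have Gq : G j (f j - (h j - t)).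
  rewrite opprB addrCA addrA -addrA; apply: idealD => //; first exact: idealMl.
  by case: (hP j).
have q0 : h j - t != 0.
  by apply/eqP => q0; apply: hno; exists j; move: Gq; rewrite q0 subr0.
move=> /(_ Gq); apply/negP; rewrite -ltNge lt_neqAle; apply/andP; split.
  by apply/eqP => e; move: q0; rewrite -mleadc_eq0 e mcoeffB tj subrr eqxx.
apply: le_trans (mleadB_le _ _) _; rewrite leUx lexx /=.
rewrite tE; apply: le_trans (mleadZ_le _ _) _; apply: le_trans (mleadM_le _ _) _.
by rewrite mleadXm addmC submK.
Qed.

(** * Powers of the maximal ideal of a point *)

Section PointIdeal.
Variables (m : nat) (a : point m).

Definition xi (j : 'I_m) : Cpoly m := 'X_j - (a j)%:MP.

(* The n-th power of the maximal ideal of [a]. *)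
Fixpoint mpow (n : nat) (p : Cpoly m) : Prop :=
  if n is n'.+1 then
    exists2 h : 'I_m -> Cpoly m, (forall j, mpow n' (h j)) & p = \sum_j xi j * h j
  else True.
Arguments mpow : simpl never.

Lemma mpow_decomp n p : mpow n.+1 p ->
  exists2 h : 'I_m -> Cpoly m, (forall j, mpow n (h j)) & p = \sum_j xi j * h j.
Proof. by []. Qed.

Lemma mpow_is_ideal n : is_ideal (mpow n).
Proof.
elim: n => [|n IH]; first by split=> //; split.
split; first by exists (fun=> 0) => [j|]; [exact: ideal0 IH|rewrite big1 // => j _; rewrite mulr0].
split=> [_ _ [g hg ->] [h hh ->]|r _ [h hh ->]].
  exists (fun j => g j + h j) => [j|]; first exact: idealD IH _ _ (hg j) (hh j).
  by rewrite -big_split; apply: eq_bigr => j _; rewrite mulrDr.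
exists (fun j => r * h j) => [j|]; first exact: idealMl IH r _ (hh j).
by rewrite mulr_sumr; apply: eq_bigr => j _; rewrite mulrCA.
Qed.

Lemma mpow_xiM n j p : mpow n p -> mpow n.+1 (xi j * p).
Proof.
move=> hp; exists (fun i => if i == j then p else 0) => [i|].
  by case: eqP => // _; apply: ideal0; apply: mpow_is_ideal.
by rewrite (bigD1 j) //= eqxx big1 ?addr0 // => i /negPf ->; rewrite mulr0.
Qed.

Lemma mpowM n q p r : mpow n p -> mpow q r -> mpow (n + q) (p * r).
Proof.
elim: n p => [|n IH] p hp hr; first by apply: (idealMl (mpow_is_ideal _)).
case: hp => h hh ->; rewrite mulr_suml; apply: (ideal_bigsum (mpow_is_ideal _)) => j _.
by rewrite -mulrA addSn; apply: mpow_xiM; apply: IH (hh j) hr.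
Qed.

Lemma mpow1P p : mpow 1 p <-> p.@[a] = 0.
Proof.
(* Every polynomial is congruent to its value at [a]; for monomials, one factor is replaced at a
   time. *)
have h1 : mpow 1 (p - (p.@[a])%:MP).
  have id1 := mpow_is_ideal 1.
  elim/mpolyind: p => [|c M p _ _ IH]; first by rewrite meval0 mpolyC0 subrr; apply: ideal0.
  rewrite mevalD mpolyCD opprD addrACA; apply: idealD => //.
  rewrite mevalZ mpolyCM mul_mpolyC -scalerBr -mul_mpolyC; apply: idealMl => //.
  rewrite mpolyXE_id rmorph_prod /= [in X in _ - X]rmorph_prod /=.
  elim/big_rec2: _ => [|i y x _ IHx]; first by rewrite subrr; apply: ideal0.
  set c' := (_.@[a])%:MP.
  have hc : mpow 1 ('X_i ^+ M i - c').
    rewrite /c' rmorphXn /= mevalXU rmorphXn /= subrXX; apply: (idealMr id1).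
    by rewrite -[_ - _]mulr1; apply: mpow_xiM.
  have -> : 'X_i ^+ M i * x - c' * y = ('X_i ^+ M i - c') * x + c' * (x - y).
    by rewrite mulrBl mulrBr addrA subrK.
  by apply: idealD => //; [apply: idealMr|apply: idealMl].
split=> [[h _ ->]|pa]; last by move: h1; rewrite pa mpolyC0 subr0.
rewrite raddf_sum big1 //= => j _.
by rewrite mevalM mevalB mevalXU mevalC subrr mul0r.
Qed.

Lemma mderiv_xi i j : (xi j)^`M(i) = (i == j)%:R.
Proof.
rewrite /xi mderivB mderivC subr0 mderivX mnm1E eq_sym; case: eqP => [->|_]; last by rewrite scale0r.
have -> : (U_(j) - U_(j) = 0 :> 'X_{1..m})%MM by rewrite -{1}[U_(j)%MM]add0m addmK.
by rewrite mpolyX0 scale1r.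
Qed.

Lemma mpow_deriv n i p : mpow n.+1 p -> mpow n p^`M(i).
Proof.
elim: n p => // n IH p /mpow_decomp[h hh ->]; rewrite raddf_sum /=.
apply: (ideal_bigsum (mpow_is_ideal _)) => j _.
rewrite mderivM; apply: idealD; first exact: mpow_is_ideal.
  by apply: (idealMl (mpow_is_ideal _)).
by apply: mpow_xiM; exact: IH (hh j).
Qed.

(** The Euler vector field centred at [a]: it multiplies forms of degree n in the [xi j] by n. *)
Definition euler (p : Cpoly m) := \sum_j xi j * p^`M(j).

(** By the product rule, each factor [xi j] raises the eigenvalue by one. *)
Lemma mpow_euler n p : mpow n p -> mpow n.+1 (euler p - p *+ n).
Proof.
elim: n p => [|n IH] p.
  move=> _; rewrite mulr0n subr0; apply: (ideal_bigsum (mpow_is_ideal _)) => j _.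
  exact: mpow_xiM.
case/mpow_decomp=> h hh ->.
have -> : euler (\sum_j xi j * h j) - (\sum_j xi j * h j) *+ n.+1 =
          \sum_j xi j * (euler (h j) - h j *+ n).
  have -> : euler (\sum_j xi j * h j) = \sum_j (xi j * h j + xi j * euler (h j)).
    rewrite /euler big_split /=.
    under eq_bigr => i _ do rewrite raddf_sum /= mulr_sumr.
    rewrite exchange_big /= -big_split /=; apply: eq_bigr => j _.
    under eq_bigr => i _ do rewrite mderivM mulrDr mderiv_xi.
    rewrite big_split /=; congr (_ + _).
      rewrite (bigD1 j) //= eqxx mul1r big1 ?addr0 // => i /negPf ->.
      by rewrite mul0r mulr0.
    by rewrite mulr_sumr; apply: eq_bigr => i _; rewrite mulrCA.
  rewrite -sumrMnl -sumrB; apply: eq_bigr => j _.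
  by rewrite mulrBr mulrnAr mulrS opprD addrACA subrr add0r.
apply: (ideal_bigsum (mpow_is_ideal _)) => j _.
by apply: mpow_xiM; exact: IH (hh j).
Qed.

(** Pigeonhole: a monomial in the [xi j] of degree above the sum of the [e j] is divisible by some
    [xi j ^+ e j]. *)
Lemma mpow_sub_xi_powers N (A : Cpoly m -> Prop) (e : 'I_m -> nat) :
  is_ideal A -> (forall j, A (xi j ^+ e j)) -> (\sum_j e j <= N)%N ->
  forall p, mpow N.+1 p -> A p.
Proof.
elim: N A e => [|N IH] A e idA hA hN p /mpow_decomp[h hh ->]; apply: ideal_bigsum => // j _.
  apply: idealMr => //; rewrite -[xi j]mulr1; apply: idealMl => //.
  by have := hA j; move: hN; rewrite leqn0 sum_nat_eq0 => /forallP/(_ j)/eqP ->.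
have [e0|e0] := posnP (e j).
  by have := hA j; rewrite e0 expr0 => A1; rewrite -[_ * _]mulr1; apply: idealMl.
(* Passing to the colon ideal of [A] by [xi j] lowers [e j] by one. *)
apply: (IH (fun q => A (xi j * q)) (fun i => e i - (i == j))%N) => //.
- split; first by rewrite mulr0; apply: ideal0.
  split=> [q r Aq Ar|r q Aq]; first by rewrite mulrDr; apply: idealD.
  by rewrite mulrCA; apply: idealMl.
- move=> i; case: eqP => [->|_]; first by rewrite -exprS subn1 prednK.
  by rewrite subn0; apply: idealMl.
- rewrite -ltnS; apply: leq_trans hN.
  rewrite (bigD1 j) //= [X in (_ < X)%N](bigD1 j) //= eqxx.
  rewrite -addSn subn1 prednK // leq_add2l; apply: leq_sum => i /negPf ->.
  by rewrite subn0.
Qed.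

End PointIdeal.

(** * Krull's intersection theorem and the Jacobian criterion *)

Definition ideal_add m (A : Cpoly m -> Prop) (x : Cpoly m) : Cpoly m -> Prop :=
  fun p => exists r, A (p - r * x).

Lemma ideal_add_is_ideal m (A : Cpoly m -> Prop) x :
  is_ideal A -> is_ideal (ideal_add A x).
Proof.
move=> idA; split; first by exists 0; rewrite mul0r subrr; apply: ideal0.
split=> [p q [r hr] [s hs]|r p [s hs]].
  exists (r + s); rewrite mulrDl opprD addrACA; exact: idealD.
exists (r * s); rewrite -mulrA -mulrBr; exact: idealMl.
Qed.

Lemma ideal_addl m (A : Cpoly m -> Prop) x p : A p -> ideal_add A x p.
Proof. by move=> Ap; exists 0; rewrite mul0r subr0. Qed.

Lemma ideal_addr m (A : Cpoly m -> Prop) x : is_ideal A -> ideal_add A x x.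
Proof. by move=> idA; exists 1; rewrite mul1r subrr; apply: ideal0. Qed.

(** Otherwise choose [f n] killed modulo [A] by [x ^+ n.+1] but not by [x ^+ n]; some [f n] is a
    combination of earlier ones, all killed by [x ^+ n]. *)
Lemma colon_chain_stable m (A : Cpoly m -> Prop) (x : Cpoly m) : is_ideal A ->
  exists n, forall r, A (x ^+ n.+1 * r) -> A (x ^+ n * r).
Proof.
move=> idA; apply: contrapT => hno.
have /choice[f hf] (n : nat) : exists r, A (x ^+ n.+1 * r) /\ ~ A (x ^+ n * r).
  apply: contrapT => hn; apply: hno; exists n => r Ar.
  by apply: contrapT => nAr; apply: hn; exists r.
have [n [c fn]] := noetherian f; case: (hf n) => _; apply.
rewrite fn mulr_sumr; apply: (ideal_bigsum idA) => i _.
rewrite mulrCA; apply: (idealMl idA).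
rewrite -[X in x ^+ X](subnK (ltn_ord i)) exprD -mulrA; apply: (idealMl idA).
by case: (hf i).
Qed.

(** If [g] is [r * x ^+ n] modulo [A], then [x ^+ n.+1 * r] lies in [A] because [x * g] does;
    stability of the colon chain then puts [g] in [A]. *)
Lemma ideal_add_power_notin m (A : Cpoly m -> Prop) (x g : Cpoly m) :
  is_ideal A -> A (x * g) -> ~ A g -> exists n, ~ ideal_add A (x ^+ n) g.
Proof.
move=> idA Axg nAg; have [n hn] := colon_chain_stable x idA.
exists n => -[r hr]; apply: nAg.
rewrite -[g](subrK (r * x ^+ n)); apply: (idealD idA) => //.
rewrite mulrC; apply: hn.
have -> : x ^+ n.+1 * r = x * g - x * (g - r * x ^+ n).
  by rewrite mulrBr opprB addrC subrK exprS -mulrA [r * _]mulrC.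
by apply: (idealB idA) => //; apply: (idealMl idA).
Qed.

(* Writing m_a for the maximal ideal of [a], enlarging I + m_a g by high powers of the coordinates one after the other
   keeps [g] out, and the resulting ideal contains a power of m_a. *)
Lemma krull_intersection m (a : point m) (I : Cpoly m -> Prop) (g : Cpoly m) :
  is_ideal I -> (forall n, exists2 i, I i & mpow a n (g - i)) ->
  exists2 s, s.@[a] != 0 & I (s * g).
Proof.
move=> idI hg; apply: contrapT => hno.
pose A p := exists2 u : Cpoly m, u.@[a] = 0 & I (p - u * g).
have idA : is_ideal A.
  split; first by exists 0; rewrite ?meval0 // mul0r subrr; apply: ideal0.
  split=> [p q [u ua hu] [v va hv]|r p [u ua hu]].
    exists (u + v); first by rewrite mevalD ua va addr0.
    by rewrite mulrDl opprD addrACA; apply: (idealD idI).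
  exists (r * u); first by rewrite mevalM ua mulr0.
  by rewrite -mulrA -mulrBr; apply: (idealMl idI).
(* Nakayama's argument: [g] congruent to [u * g] would give the multiplier [1 - u], with value 1 at
   [a]. *)
have nAg : ~ A g.
  case=> u ua hu; apply: hno; exists (1 - u); last by rewrite mulrBl mul1r.
  by rewrite mevalB meval1 ua subr0 oner_eq0.
have IA p : I p -> A p by move=> Ip; exists 0; rewrite ?meval0 // mul0r subr0.
have xA j : A (xi a j * g).
  exists (xi a j); last by rewrite subrr; apply: ideal0.
  by rewrite mevalB mevalXU mevalC subrr.
have [B [idB AB nBg hB]] : exists B, [/\ is_ideal B, forall p, A p -> B p, ~ B g &
    forall j, j \in enum 'I_m -> exists n, B (xi a j ^+ n)].
  elim: (enum 'I_m) => [|j l [B [idB AB nBg hB]]]; first by exists A; split.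
  have [n hn] := ideal_add_power_notin idB (AB _ (xA j)) nBg.
  exists (ideal_add B (xi a j ^+ n)); split=> //.
  - exact: ideal_add_is_ideal.
  - by move=> p /AB; apply: ideal_addl.
  - move=> i; rewrite inE => /predU1P[->|/hB[q hq]]; first by exists n; apply: ideal_addr.
    by exists q; apply: ideal_addl.
have /choice[e he] (j : 'I_m) : exists n, B (xi a j ^+ n) by apply: hB; rewrite mem_enum.
(* This exponent puts the power of the maximal ideal inside [B]. *)
have [i Ii hi] := hg (\sum_j e j).+1.
apply: nBg; rewrite -[g](subrK i); apply: (idealD idB); last by apply/AB/IA.
exact: mpow_sub_xi_powers hi.
Qed.

Lemma CC_natS_neq0 n : n.+1%:R != 0 :> CC.
Proof. by have := Num.Theory.pnatr_eq0 (complex Rdefinitions.R) n.+1 => ->. Qed.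

Definition vector_field m (v : 'I_m -> Cpoly m) (h : Cpoly m) : Cpoly m :=
  \sum_i v i * h^`M(i).

Lemma vector_fieldM m (v : 'I_m -> Cpoly m) p q :
  vector_field v (p * q) = vector_field v p * q + p * vector_field v q.
Proof.
rewrite /vector_field mulr_suml mulr_sumr -big_split; apply: eq_bigr => i _ /=.
by rewrite mderivM mulrDr; congr (_ + _); [rewrite mulrA|rewrite mulrCA].
Qed.

Lemma vector_fieldD m (v : 'I_m -> Cpoly m) p q :
  vector_field v (p + q) = vector_field v p + vector_field v q.
Proof.
by rewrite /vector_field -big_split; apply: eq_bigr => i _; rewrite mderivD mulrDr.
Qed.

Lemma vector_field0 m (v : 'I_m -> Cpoly m) : vector_field v 0 = 0.
Proof. by apply: big1 => i _; rewrite mderiv0 mulr0. Qed.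

Definition jacobian m k (D : 'I_k -> Cpoly m) : 'M[Cpoly m]_(k, m) :=
  \matrix_(i, j) (D i)^`M(j).

Definition jacobian_at m k (a : point m) (D : 'I_k -> Cpoly m) : 'M[CC]_(k, m) :=
  \matrix_(i, j) ((D i)^`M(j)).@[a].

(** A right inverse of the Jacobian at [a], taken as a constant matrix, makes the product the
    identity at [a]; its determinant is [Delta], and the adjugate supplies [C]. *)
Lemma jacobian_quasi_inverse m k (a : point m) (D : 'I_k -> Cpoly m) :
  row_free (jacobian_at a D) ->
  exists Delta (C : 'M_(m, k)), Delta.@[a] = 1 /\ jacobian D *m C = Delta%:M.
Proof.
move=> Jfree; pose B : 'M[Cpoly m]_(m, k) := map_mx (@mpolyC m CC) (pinvmx (jacobian_at a D)).
exists (\det (jacobian D *m B)), (B *m \adj (jacobian D *m B)).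
split; last by rewrite mulmxA mul_mx_adj.
rewrite -det_map_mx map_mxM.
have -> : map_mx (meval a) (jacobian D) = jacobian_at a D by apply/matrixP => i j; rewrite !mxE.
have -> : map_mx (meval a) B = pinvmx (jacobian_at a D).
  by apply/matrixP => i j; rewrite !mxE mevalC.
by rewrite mulmxVp // det1.
Qed.

Section TangentFields.
Variables (m k : nat) (a : point m) (D : 'I_k -> Cpoly m).
Variables (Delta : Cpoly m) (C : 'M[Cpoly m]_(m, k)).
Hypothesis Delta_a : Delta.@[a] = 1.
Hypothesis jacobianC : jacobian D *m C = Delta%:M.

(* These vector fields annihilate all [D i], and at [a] they span the kernel of
   the Jacobian. *)
Definition theta (j : 'I_m) : Cpoly m -> Cpoly m :=
  vector_field (fun i => (Delta%:M - C *m jacobian D) i j).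

Lemma theta_D j l : theta j (D l) = 0.
Proof.
transitivity ((jacobian D *m (Delta%:M - C *m jacobian D)) l j).
  by rewrite mxE; apply: eq_bigr => i _; rewrite mulrC; congr (_ * _); rewrite mxE.
by rewrite mulmxBr mulmxA jacobianC mul_scalar_mx mul_mx_scalar subrr mxE.
Qed.

Lemma theta_gen_ideal j p : gen_ideal D p -> gen_ideal D (theta j p).
Proof.
have idI := gen_ideal_is_ideal D.
case=> c ->; elim/big_rec: _ => [|i q _ hq].
  by rewrite /theta vector_field0; apply: ideal0.
have := theta_D j i; rewrite /theta vector_fieldD vector_fieldM => ->.
rewrite mulr0 addr0; apply: (idealD idI) => //; by apply: (idealMl idI); apply: gen_ideal_mem.
Qed.

(** Expresses [Delta * euler a h] through the tangent fields, up to terms in [euler a (D l)], which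
    agrees with [D l] to second order when [D l] vanishes at [a]. *)
Lemma sum_xi_theta h : \sum_j xi a j * theta j h =
  Delta * euler a h - \sum_i \sum_l C i l * (euler a (D l) * h^`M(i)).
Proof.
have e i j : (Delta%:M - C *m jacobian D) i j =
    Delta *+ (i == j) - \sum_l C i l * (D l)^`M(j).
  by rewrite !mxE; congr (_ - _); apply: eq_bigr => l _; rewrite mxE.
rewrite /theta /vector_field; under eq_bigr => j _ do rewrite mulr_sumr.
rewrite exchange_big /= /euler mulr_sumr -sumrB; apply: eq_bigr => i _ /=.
under eq_bigr => j _ do rewrite e [X in _ * X]mulrBl mulrBr.
rewrite sumrB; congr (_ - _).
  rewrite (bigD1 i) //= eqxx big1 ?addr0 => [|j]; first by rewrite mulrCA.
  by rewrite eq_sym => /negPf ->; rewrite mul0r mulr0.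
under eq_bigr => j _ do rewrite mulr_suml mulr_sumr.
rewrite exchange_big; apply: eq_bigr => l _ /=.
rewrite mulr_suml mulr_sumr; apply: eq_bigr => j _.
by rewrite -!mulrA mulrCA.
Qed.

(** Induction on the order of vanishing: the remainder [h] is recovered from [Delta * euler a h],
    since modulo the next power [Delta] acts on it as 1 and the Euler field as [n.+1]. *)
Lemma stable_ideal_sub_mpow (Q : Cpoly m -> Prop) :
  is_ideal Q -> (forall p, Q p -> p.@[a] = 0) -> (forall i, Q (D i)) ->
  (forall j p, Q p -> Q (theta j p)) ->
  forall n p, Q p -> exists2 i, gen_ideal D i & mpow a n (p - i).
Proof.
move=> idQ Qa QD Qth; have idI := gen_ideal_is_ideal D.
have IQ := gen_ideal_sub idQ QD.
elim=> [|n IH] p Qp; first by exists 0 => //; apply: ideal0.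
(* Order 1 is handled directly: in degree 0 the Euler field would only give a multiple by 0. *)
case: n IH => [|n] IH; first by exists 0; [apply: ideal0|rewrite subr0; apply/mpow1P/Qa].
have idM := mpow_is_ideal a n.+2.
pose A q := exists2 i, gen_ideal D i & mpow a n.+2 (q - i).
have idA : is_ideal A.
  split; first by exists 0; rewrite ?subrr; apply: ideal0.
  split=> [q r [u Iu hu] [v Iv hv]|r q [u Iu hu]].
    exists (u + v); first exact: (idealD idI).
    by rewrite opprD addrACA; apply: (idealD idM).
  by exists (r * u); [apply: (idealMl idI)|rewrite -mulrBr; apply: (idealMl idM)].
have IA q : gen_ideal D q -> A q by exists q; rewrite ?subrr //; apply: ideal0.
have MA q : mpow a n.+2 q -> A q by exists 0; rewrite ?subr0 //; apply: ideal0.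
have [i Ii hi] := IH p Qp; set h := p - i in hi.
have Qh : Q h by apply: (idealB idQ) => //; apply: IQ.
suff Ah : A h by rewrite -[p](subrK i); apply: (idealD idA) => //; apply: IA.
have A1 : A (Delta * euler a h).
  have -> : Delta * euler a h = \sum_j xi a j * theta j h +
      \sum_i0 \sum_l C i0 l * (euler a (D l) * h^`M(i0)) by rewrite sum_xi_theta subrK.
  apply: (idealD idA).
    apply: (ideal_bigsum idA) => j _; have [u Iu hu] := IH _ (Qth j h Qh).
    exists (xi a j * u); first exact: (idealMl idI).
    by rewrite -mulrBr; apply: mpow_xiM.
  apply: (ideal_bigsum idA) => j _; apply: (ideal_bigsum idA) => l _.
  (* [euler a (D l) - D l] has order 2 and the derivative of [h] has order [n]. *)
  apply: (idealMl idA); rewrite -[euler a (D l)](subrK (D l)) mulrDl.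
  apply: (idealD idA); last by apply: IA; apply: (idealMr idI); apply: gen_ideal_mem.
  apply: MA; rewrite -[n.+2]/(2 + n)%N; apply: mpowM; last exact: mpow_deriv.
  by apply: (mpow_euler (n := 1)); apply/mpow1P/Qa.
have A2 : A (Delta * (h *+ n.+1)).
  rewrite -[h *+ _](subKr (euler a h)) mulrBr; apply: (idealB idA) => //.
  by apply: (idealMl idA); apply: MA; apply: mpow_euler.
have A3 : A (h *+ n.+1).
  rewrite -[h *+ _](subKr (Delta * (h *+ n.+1))); apply: (idealB idA) => //.
  apply: MA; rewrite -{2}[h *+ _]mul1r -mulrBl -[n.+2]/(1 + n.+1)%N; apply: mpowM.
    by apply/mpow1P; rewrite mevalB Delta_a meval1 subrr.
  by rewrite -mulr_natl; apply: (idealMl (mpow_is_ideal _ _)).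
have -> : h = ((n.+1%:R)^-1)%:MP * (h *+ n.+1).
  by rewrite mul_mpolyC -[h *+ _]scaler_nat scalerA mulVf ?scale1r // CC_natS_neq0.
exact: (idealMl idA).
Qed.

End TangentFields.

(* At a point of full Jacobian rank, [D] is locally primary: a power of [t] is
   locally in [(D)] or [t] is locally a nonzerodivisor modulo [(D)]. *)
Lemma gen_ideal_primary_at m k (a : point m) (D : 'I_k -> Cpoly m)
  (t g : Cpoly m) (e : nat) :
  row_free (jacobian_at a D) -> (forall i, (D i).@[a] = 0) ->
  gen_ideal D (t ^+ e * g) ->
  (exists f s, s.@[a] != 0 /\ gen_ideal D (t ^+ f * s)) \/
  (exists2 s, s.@[a] != 0 & gen_ideal D (s * g)).
Proof.
move=> Jfree Da Itg; have idI := gen_ideal_is_ideal D.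
have [Delta [C [Delta_a JC]]] := jacobian_quasi_inverse Jfree.
pose Q p := exists f : nat, gen_ideal D (t ^+ f * p).
have idQ : is_ideal Q.
  split; first by exists 0%N; rewrite mulr0; apply: ideal0.
  split=> [p q [u hu] [v hv]|r p [u hu]]; last first.
    by exists u; rewrite mulrCA; apply: (idealMl idI).
  exists (u + v)%N; rewrite mulrDr exprD; apply: (idealD idI).
    by rewrite mulrAC; apply: (idealMr idI).
  by rewrite -mulrA; apply: (idealMl idI).
(* Either the saturation [Q] contains an element nonzero at [a], or it vanishes at [a] and the
   tangent fields apply. *)
have [[s sa [f hf]]|Qa] := pselect (exists2 s, s.@[a] != 0 & Q s).
  by left; exists f, s.
right; apply: (krull_intersection idI) => n.
apply: (stable_ideal_sub_mpow Delta_a idQ (C := C)) => [p Qp|i|j p [f hf]|]; last by exists e.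
- by apply/eqP; apply: contrapT => /negP pa; apply: Qa; exists p.
- by exists 0%N; apply: (idealMl idI); apply: gen_ideal_mem.
(* Doubling the exponent absorbs the derivative of [t ^+ f] in the product rule. *)
pose th := theta D Delta C j; exists (f + f)%N.
have -> : t ^+ (f + f) * th p = t ^+ f * th (t ^+ f * p) - th (t ^+ f) * (t ^+ f * p).
  by rewrite [th (_ * _)]vector_fieldM mulrDr exprD -mulrA [X in X + _ - _]mulrCA addrAC subrr add0r.
by apply: (idealB idI); apply: (idealMl idI) => //; apply: theta_gen_ideal JC _ _ hf.
Qed.

(** * The Nullstellensatz *)

Section RealsUncountable.
Import Rdefinitions.
Local Delimit Scope R_scope with Re.

(** Nested intervals: [step] keeps the right half if [x] is left of the midpoint, and otherwise the
    left quarter, so that the midpoint itself is avoided too. The supremum of the left ends lies in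
    all intervals. *)
Lemma R_uncountable (u : nat -> R) : exists x, forall n, u n <> x.
Proof.
pose step (I : R * R) x :=
  if RIneq.Rlt_dec x ((I.1 + I.2) / 2)%Re then (((I.1 + I.2) / 2)%Re, I.2)
  else (I.1, ((3 * I.1 + I.2) / 4)%Re).
pose I := fix I n := if n is n'.+1 then step (I n') (u n') else (0%Re, 1%Re).
have lr n : ((I n).1 < (I n).2)%Re.
  by elim: n => [|n IH] /=; [lra|rewrite /step; case: RIneq.Rlt_dec => /=; lra].
have mono n : ((I n).1 <= (I n.+1).1)%Re /\ ((I n.+1).2 <= (I n).2)%Re.
  by have := lr n; rewrite /= /step; case: RIneq.Rlt_dec => /=; lra.
have monoD n p : ((I n).1 <= (I (addn n p)).1)%Re /\ ((I (addn n p)).2 <= (I n).2)%Re.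
  elim: p => [|p]; first by rewrite addn0; lra.
  by rewrite addnS; have := mono (addn n p); lra.
have cross n p : ((I n).1 <= (I p).2)%Re.
  have := (monoD n p).1; have := (monoD p n).2; have := lr (addn n p).
  by rewrite [addn p n]addnC; lra.
have [||x [x_ub x_lub]] := Raxioms.completeness (fun x => exists n, x = (I n).1).
- by exists 1%Re => _ [n ->]; have := cross n O.
- by exists 0%Re; exists O.
exists x => n e.
have x1 : ((I n.+1).1 <= x)%Re by apply: x_ub; exists n.+1.
have x2 : (x <= (I n.+1).2)%Re by apply: x_lub => _ [p ->].
by have := lr n; move: x1 x2; rewrite /= /step -e; case: RIneq.Rlt_dec => /=; lra.
Qed.

End RealsUncountable.

(** If all fibres were finite, pairs (value, position in the fibre) would enumerate the reals. *)
Lemma infinite_fibre (f : Rdefinitions.R -> nat) :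
  exists N, forall d, exists s : seq Rdefinitions.R,
    [/\ uniq s, size s = d & forall x, x \in s -> f x = N].
Proof.
apply: contrapT => hno.
have /choice[l hl] (N : nat) : exists l : seq Rdefinitions.R, forall x, f x = N -> x \in l.
  apply: contrapT => hN; apply: hno; exists N.
  elim=> [|d [s [us ss hs]]]; first by exists [::].
  have [x fx xs] : exists2 x, f x = N & x \notin s.
    apply: contrapT => hx; apply: hN; exists s => x fx.
    by apply: contrapT => /negP xs; apply: hx; exists x.
  exists (x :: s); split; rewrite /= ?xs ?ss // => y.
  by rewrite inE => /predU1P[->|/hs].
pose u n := if unpickle n is Some q then nth 0 (l q.1) q.2 else 0.
have [x hx] := R_uncountable u.
apply: (hx (pickle (f x, index x (l (f x))))).
by rewrite /u pickleK /= nth_index // hl.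
Qed.

(** There is one polynomial more than there are monomials of degree below [n]. *)
Lemma exists_linear_relation m n (r : 'I_(#|{: 'X_{1..m < n}}|).+1 -> Cpoly m) :
  (forall i, msize (r i) <= n)%N ->
  exists2 c : 'I_(#|{: 'X_{1..m < n}}|).+1 -> CC,
    (exists i, c i != 0) & \sum_i c i *: r i = 0.
Proof.
move=> hr; set d := #|_| in r hr *.
pose A : 'M[CC]_(d.+1, d) := \matrix_(i, b) (r i)@_(enum_val b : 'X_{1..m < n}).
have /rowV0Pn[v vK v0] : kermx A != 0.
  by rewrite kermx_eq0 /row_free neq_ltn (leq_ltn_trans (rank_leq_col A)).
exists (fun i => v 0 i).
  apply: contrapT => h; case/negP: v0; apply/eqP/rowP => i; rewrite mxE.
  by apply/eqP; apply: contrapT => /negP vi; apply: h; exists i.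
apply/mpolyP => M; rewrite raddf_sum mcoeff0 /=.
have [Mn|Mn] := ltnP (mdeg M) n; last first.
  rewrite big1 // => i _; rewrite mcoeffZ memN_msupp_eq0 ?mulr0 //.
  by apply: msize_mdeg_ge; apply: leq_trans (hr i) Mn.
have /matrixP/(_ 0 (enum_rank (BMultinom Mn))) := sub_kermxP vK.
rewrite !mxE => e; rewrite -[RHS]e; apply: eq_bigr => i _.
by rewrite mcoeffZ mxE enum_rankK.
Qed.

(** Linear factors are removed one at a time, each at the cost of a further power of [p], which is a
    multiple of that factor modulo [S]. *)
Lemma radical_of_poly m (S : Cpoly m -> Prop) (p : Cpoly m) (j : 'I_m) (s : seq CC) :
  is_ideal S -> (forall c, radical (ideal_add S ('X_j - c%:MP)) p) ->
  forall e, S (p ^+ e * \prod_(z <- s) ('X_j - z%:MP)) -> radical S p.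
Proof.
move=> idS hc; elim: s => [|z s IH] e; first by rewrite big_nil mulr1; exists e.
rewrite big_cons => h; have [f [r hr]] := hc z; apply: (IH (e + f)%N).
set P := \prod_(_ <- _) _ in h *.
have -> : p ^+ (e + f) * P = p ^+ e * P * (p ^+ f - r * ('X_j - z%:MP))
   + r * (p ^+ e * (('X_j - z%:MP) * P)).
  rewrite exprD mulrBr [X in _ - X](_ : _ = r * (p ^+ e * (('X_j - z%:MP) * P))).
    by rewrite subrK mulrAC.
  by rewrite mulrCA -!mulrA [P * _]mulrC.
by apply: (idealD idS); apply: (idealMl idS).
Qed.

(* Otherwise each [X_j - c] divides a power of [p] modulo [S]. With [c] ranging
   over an uncountable set, finitely many of the quotients are linearly dependent,
   so [S] contains a power of [p] times a nonzero polynomial in [X_j] alone. *)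
Lemma nullstellensatz_step m (S : Cpoly m -> Prop) (p : Cpoly m) (j : 'I_m) :
  is_ideal S -> ~ radical S p ->
  exists c, ~ radical (ideal_add S ('X_j - c%:MP)) p.
Proof.
move=> idS nSp; apply: contrapT => hno.
have hc c : radical (ideal_add S ('X_j - c%:MP)) p.
  by apply: contrapT => h; apply: hno; exists c.
have /choice[w hw] (c : CC) : exists w : nat * Cpoly m, S (p ^+ w.1 - w.2 * ('X_j - c%:MP)).
  by have [e [r hr]] := hc c; exists (e, r).
pose inj (x : Rdefinitions.R) : CC := x%:C%C.
have inj_inj : injective inj by move=> x y [].
(* Encoding both data fixes the exponent of [p] and bounds the degrees of the quotients. *)
have [N hN] := infinite_fibre (fun x => pickle ((w (inj x)).1, msize (w (inj x)).2)).
have [s0 [_ s01 hs0]] := hN 1%N.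
case: s0 s01 hs0 => // x0 s0 _ /(_ x0); rewrite mem_head => /(_ isT) hx0.
set E := (w (inj x0)).1 in hx0; set n := msize _ in hx0.
have [s [us ss hs]] := hN (#|{: 'X_{1..m < n}}|).+1.
set d := #|_| in ss.
pose c (i : 'I_d.+1) : CC := inj (nth x0 s i).
have c_inj : injective c.
  move=> i l /inj_inj/eqP; rewrite nth_uniq ?ss // => /eqP; exact: val_inj.
have wc (i : 'I_d.+1) : (w (c i)).1 = E /\ msize (w (c i)).2 = n.
  have := hs _ (mem_nth x0 (_ : (i < size s)%N)); rewrite ss => /(_ (ltn_ord i)).
  by rewrite -hx0 => /(pcan_inj (@pickleK _)) [].
have [lam [i0 lam0] hlam] := @exists_linear_relation m n (fun i => (w (c i)).2)
  (fun i => eq_leq (wc i).2).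
(* At the node [c i0] only the term of index [i0] survives, so [q] is nonzero. *)
pose q : {poly CC} := \sum_i lam i *: \prod_(l | l != i) ('X - (c l)%:P).
have q0 : q != 0.
  apply/eqP => /(congr1 (fun q : {poly CC} => q.[c i0])); rewrite horner0 horner_sum.
  rewrite (bigD1 i0) //= [X in _ + X]big1 ?addr0.
    rewrite hornerZ horner_prod => /eqP; rewrite mulf_eq0 (negPf lam0) /=.
    case/prodf_eq0 => l li; rewrite hornerXsubC subr_eq0 => /eqP/c_inj e.
    by rewrite e eqxx in li.
  move=> i ii0; rewrite hornerZ horner_prod (bigD1 i0) 1?eq_sym //=.
  by rewrite hornerXsubC subrr mul0r mulr0.
pose ev (r : {poly CC}) : Cpoly m := (map_poly (@mpolyC m CC) r).['X_j].
have evZ a r : ev (a *: r) = a%:MP * ev r by rewrite /ev map_polyZ hornerZ.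
have evXC z : ev ('X - z%:P) = 'X_j - z%:MP by rewrite /ev map_polyXsubC hornerXsubC.
have evq : ev q = \sum_i (lam i)%:MP * \prod_(l | l != i) ('X_j - (c l)%:MP).
  rewrite {1}/ev rmorph_sum horner_sum; apply: eq_bigr => i _; rewrite -/(ev _) evZ.
  by rewrite /ev rmorph_prod horner_prod; congr (_ * _); apply: eq_bigr => l _; apply: evXC.
have Sq : S (p ^+ E * ev q).
  (* The subtracted terms add up to the linear relation times the product of all linear factors,
     hence to zero. *)
  have -> : p ^+ E * ev q = \sum_i (lam i)%:MP *
     (\prod_(l | l != i) ('X_j - (c l)%:MP) * (p ^+ E - (w (c i)).2 * ('X_j - (c i)%:MP))).
    under [RHS]eq_bigr => i _ do rewrite mulrBr mulrBr.
    rewrite sumrB [X in _ - X](_ : _ = 0) ?subr0.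
      by rewrite evq mulr_sumr; apply: eq_bigr => i _; rewrite mulrCA [p ^+ E * _]mulrC.
    transitivity ((\sum_i lam i *: (w (c i)).2) * \prod_l ('X_j - (c l)%:MP)).
      rewrite mulr_suml; apply: eq_bigr => i _; rewrite [in RHS](bigD1 i) //= -scalerAl mul_mpolyC.
      by congr (_ *: _); rewrite mulrC -mulrA.
    by rewrite hlam mul0r.
  apply: (ideal_bigsum idS) => i _; apply: (idealMl idS); apply: (idealMl idS).
  by have := hw (c i); rewrite (wc i).1.
have [z qz] := closed_field_poly_normal q.
apply: nSp; apply: (radical_of_poly (s := z) (e := E) idS hc).
have -> : \prod_(z <- z) ('X_j - z%:MP) = (lead_coef q)^-1%:MP * ev q.
  rewrite [in ev q]qz evZ mulrA -mpolyCM mulVf ?lead_coef_eq0 // mpolyC1 mul1r.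
  rewrite /ev rmorph_prod horner_prod; apply: eq_bigr => x _; exact/esym/evXC.
by rewrite mulrCA; apply: (idealMl idS).
Qed.

(** Fixing every coordinate while keeping [p] out of the radical yields an ideal containing the
    maximal ideal of a point [c], which is then a zero of [S] where [p] does not vanish. *)
Lemma nullstellensatz m (S : Cpoly m -> Prop) (p : Cpoly m) :
  is_ideal S -> (forall x, zero_locus S x -> p.@[x] = 0) -> radical S p.
Proof.
move=> idS hp; apply: contrapT => nSp.
have [T [idT ST nTp hT]] : exists T, [/\ is_ideal T, forall q, S q -> T q, ~ radical T p &
    forall j, j \in enum 'I_m -> exists c, T ('X_j - c%:MP)].
  elim: (enum 'I_m) => [|j l [T [idT ST nTp hT]]]; first by exists S; split.
  have [c hc] := nullstellensatz_step j idT nTp.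
  exists (ideal_add T ('X_j - c%:MP)); split=> //.
  - exact: ideal_add_is_ideal.
  - by move=> q /ST; apply: ideal_addl.
  - move=> i; rewrite inE => /predU1P[->|/hT[b hb]]; first by exists c; apply: ideal_addr.
    by exists b; apply: ideal_addl.
have /choice[c hc] (j : 'I_m) : exists c, T ('X_j - c%:MP) by apply: hT; rewrite mem_enum.
have mT q : q.@[c] = 0 -> T q.
  case/mpow1P/mpow_decomp => h _ ->; apply: (ideal_bigsum idT) => j _.
  by apply: (idealMr idT); apply: hc.
apply: nTp; have [pc|/eqP pc] := eqVneq p.@[c] 0; first by exists 1%N; rewrite expr1; apply: mT.
exists 0%N; rewrite expr0; apply: contrapT => nT1; apply/pc/hp => q Sq.
apply/eqP; apply: contrapT => /negP qc; apply: nT1.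
have -> : 1 = (q.@[c])^-1%:MP * (q - (q - (q.@[c])%:MP)).
  by rewrite opprB addrC subrK -mpolyCM mulVf // mpolyC1.
apply: (idealMl idT); apply: (idealB idT); first exact: ST.
by apply: mT; rewrite mevalB mevalC subrr.
Qed.

(** * Crossings of components and gluing *)

(** No power of [s] lies in [Q], since none vanishes at [x]. *)
Lemma primary_unit_at m (Q : Cpoly m -> Prop) (x : point m) (p s : Cpoly m) :
  is_primary Q -> zero_locus Q x -> s.@[x] != 0 -> Q (p * s) -> Q p.
Proof.
move=> [_ [_ prQ]] Qx sx Qps; apply: contrapT => nQp.
have [e /Qx] := prQ _ _ Qps nQp.
by rewrite rmorphXn /= => /eqP; rewrite expf_eq0 (negPf sx) andbF.
Qed.

(** By irredundancy some [g] lies in all components but one, and a power of [t] times [g] lies in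
    the whole ideal. At full rank, local primariness would force [t] into the radical of the other
    component or [g] into the excluded one. *)
Lemma jacobian_drops_at_crossing m k n (D : 'I_k -> Cpoly m)
    (Ii : nat -> Cpoly m -> Prop) (i j : nat) (x : point m) :
  irredundant_primary_decomposition (gen_ideal D) Ii n ->
  (i < n)%N -> (j < n)%N -> i <> j ->
  zero_locus (Ii i) x -> zero_locus (Ii j) x -> ~~ row_free (jacobian_at x D).
Proof.
move=> [IE [prI [radI irrI]]] ltin0 ltjn0 neij xi0 xj0; apply/negP => Jfree.
(* Distinct radicals give a [t] in just one of them; [key] covers both orders. *)
suff key i' j' t : (i' < n)%N -> (j' < n)%N -> zero_locus (Ii i') x -> zero_locus (Ii j') x ->
    radical (Ii j') t -> ~ radical (Ii i') t -> False.
  apply: (radI i j ltin0 ltjn0 neij) => p.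
  by split=> hp; apply: contrapT => nhp; [apply: (key j i p)|apply: (key i j p)].
move=> ltin ltjn xi xj [e te] nt.
have Da l : (D l).@[x] = 0.
  by apply: xi; apply: (IE (D l)).1 => //; apply: gen_ideal_mem.
have [g gI nIg] : exists2 g, (forall l, (l < n)%N -> j' <> l -> Ii l g) & ~ gen_ideal D g.
  apply: contrapT => hno; apply: (irrI j' ltjn) => g gI.
  apply: contrapT => nIg; apply: hno; exists g => // l ltln jl.
  by apply: gI => // /esym.
have nIjg : ~ Ii j' g.
  move=> Ijg; apply/nIg/IE => l ltln.
  by have [<-//|/eqP] := eqVneq j' l; apply: gI.
have Itg : gen_ideal D (t ^+ e * g).
  apply/IE => l ltln; have idl : is_ideal (Ii l) by case: (prI l ltln).
  have [<-|/eqP jl] := eqVneq j' l; first by apply: idealMr => //; case: (prI j' ltjn).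
  by apply: (idealMl idl); apply: gI.
have [[f [s [sx /IE Is]]]|[s sx /IE Is]] := gen_ideal_primary_at Jfree Da Itg.
  by apply: nt; exists f; apply: (primary_unit_at (prI i' ltin) xi sx (Is _ ltin)).
by apply/nIjg/(primary_unit_at (prI j' ltjn) xj sx); rewrite mulrC; apply: Is.
Qed.

(** Components are added one at a time: the discrepancy vanishes on the zero locus of the ideal sum,
    so it splits as [q + r], and [q] can be subtracted without disturbing the earlier
    congruences. *)
Lemma glue_mod_ideals m n (I : nat -> Cpoly m -> Prop) (beta : nat -> Cpoly m) :
  (forall i, (i < n)%N -> is_ideal (I i)) ->
  (forall i, (i.+1 < n)%N -> is_radical_ideal (ideal_sum (Jcap I i) (I i.+1))) ->
  (forall i j, (i < n)%N -> (j < n)%N -> i <> j -> forall x,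
     zero_locus (I i) x -> zero_locus (I j) x -> (beta i).@[x] = (beta j).@[x]) ->
  exists p, forall i, (i < n)%N -> I i (p - beta i).
Proof.
move=> idI radI agree; case: n => [|n] in idI radI agree *; first by exists 0.
suff: forall i, (i < n.+1)%N -> exists p, forall j, (j <= i)%N -> I j (p - beta j).
  by move=> /(_ n (ltnSn n)).
elim=> [_|i IH ltin].
  exists (beta 0%N) => j; rewrite leqn0 => /eqP ->; rewrite subrr.
  exact: ideal0 (idI _ _).
have [p hp] := IH (ltnW ltin); have [idS radS] := radI i ltin.
set S := ideal_sum _ _ in idS radS.
have JS q : Jcap I i q -> S q.
  by move=> Jq; exists q, 0; split=> //; split; [apply: ideal0 (idI _ _)|rewrite addr0].
have IS q : I i.+1 q -> S q.
  move=> Iq; exists 0, q; split; last by rewrite add0r.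
  by move=> j ji; apply: ideal0 (idI _ _); apply: leq_ltn_trans ji (ltnW ltin).
have [q [r [Jq [Ir pE]]]] : S (p - beta i.+1).
  apply/radS/nullstellensatz => // x xS.
  have xi1 : zero_locus (I i.+1) x by move=> f /IS /xS.
  (* A zero of an intersection is a zero of some component: otherwise a product of elements
     nonvanishing at [x] lies in the intersection. *)
  have [j ji xj] : exists2 j, (j <= i)%N & zero_locus (I j) x.
    apply: contrapT => hno.
    have /choice[f hf] (j : nat) : exists f, (j <= i)%N -> I j f /\ f.@[x] != 0.
      have [ji|ji] := leqP j i; last by exists 0.
      apply: contrapT => hj; apply: hno; exists j => // f If.
      by apply/eqP; apply: contrapT => /negP fx; apply: hj; exists f.
    have /xS /eqP : S (\prod_(j < i.+1) f j).
      apply: JS => j ji; rewrite (bigD1 (Ordinal (ji : (j < i.+1)%N))) //=.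
      apply: idealMr; last by case: (hf j ji).
      by apply: idI; apply: leq_ltn_trans ji (ltnW ltin).
    rewrite rmorph_prod /= => /prodf_eq0[j _].
    by case: (hf j (ltn_ord j)) => _ /negPf ->.
  rewrite mevalB -(agree j) //; first by rewrite -mevalB; apply: xj; apply: hp.
    by apply: leq_ltn_trans ji (ltnW ltin).
  by move=> e; rewrite e ltnn in ji.
exists (p - q) => j; rewrite leq_eqVlt => /orP[/eqP ->|ji].
  by rewrite addrAC pE addrC addKr.
have ltjn : (j < n.+1)%N by apply: ltn_trans ji ltin.
by rewrite addrAC; apply: idealB (idI _ ltjn) _ _ (hp j ji) (Jq j ji).
Qed.

(** * Wedge products with differentials, and their values at a point *)

Lemma setU1_disjointE (T : finType) (A K : {set T}) (j : T) :
  (A :|: [set j] == K) && [disjoint A & [set j]] = (j \in K) && (A == K :\ j).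
Proof.
rewrite disjoint_sym disjoints1 setUC; apply/andP/andP => -[].
  by move=> /eqP <- jA; rewrite setU11 setU1K.
by move=> jK /eqP ->; rewrite setD1K // setD11.
Qed.

Lemma wedge_dpolyE m (w : dform m) (d : Cpoly m) (K : {set 'I_m}) :
  wedge w (dpoly d) K =
  \sum_(j in K) wedge_sign (K :\ j) [set j] * w (K :\ j) * d^`M(j).
Proof.
transitivity (\sum_(I : {set 'I_m}) \sum_(j : 'I_m)
   if (j \in K) && (I == K :\ j) then
     wedge_sign I [set j] * w I * d^`M(j) else 0).
  apply: eq_bigr => I _; under eq_bigr => J _ do rewrite /dpoly mulr_sumr.
  rewrite exchange_big; apply: eq_bigr => j _ /=; rewrite -setU1_disjointE.
  rewrite big_mkcond (bigD1 [set j]) //= eqxx [X in _ + X]big1 ?addr0 // => J /negPf ->.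
  by rewrite mulr0; exact: if_same.
rewrite exchange_big [RHS]big_mkcond; apply: eq_bigr => j _ /=.
rewrite (bigD1 (K :\ j)) //= eqxx andbT [X in _ + X]big1 ?addr0 // => I /negPf ->.
by rewrite andbF.
Qed.

Lemma wedge_dpoly_rank m r (w : dform m) (d : Cpoly m) :
  form_of_rank r w -> form_of_rank r.+1 (wedge w (dpoly d)).
Proof.
move=> wr K Kr; rewrite wedge_dpolyE big1 // => j jK.
rewrite wr ?mulr0 ?mul0r // => e; apply: Kr.
by rewrite (cardsD1 j) jK e.
Qed.

Lemma wedge_dD_rank m k r (w : dform m) (D : 'I_k -> Cpoly m) :
  form_of_rank r w -> form_of_rank (r + k) (wedge_dD w D).
Proof.
rewrite /wedge_dD -[X in (r + X)%N](size_enum_ord k).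
elim: (enum 'I_k) r w => [|i t IH] r w wr /=; first by rewrite addn0.
by rewrite addnS -addSn; apply: IH; apply: wedge_dpoly_rank.
Qed.

Section WedgeAtPoint.
Variable m : nat.

Definition above (K : {set 'I_m}) (j : 'I_m) : nat := #|[set i in K | (j < i)%N]|.

(** Right exterior multiplication by the covector [v], in coordinates over the field [CC], where
    linear dependence can be exploited. *)
Definition rwedge (v : 'I_m -> CC) (w : {set 'I_m} -> CC) (K : {set 'I_m}) : CC :=
  \sum_(j in K) (-1) ^+ above (K :\ j) j * w (K :\ j) * v j.

Lemma eval_wedge_dpoly (x : point m) (w : dform m) (d : Cpoly m) K :
  (wedge w (dpoly d) K).@[x] =
  rwedge (fun j => d^`M(j).@[x]) (fun L => (w L).@[x]) K.
Proof.
rewrite wedge_dpolyE raddf_sum; apply: eq_bigr => j _ /=.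
rewrite !mevalM /wedge_sign rmorphXn /= mevalN meval1; congr (_ ^+ _ * _ * _).
have pair_inj : injective (fun i : 'I_m => (i, j)) by move=> p q [].
rewrite /above -(card_imset _ pair_inj); apply: eq_card => -[p q].
rewrite inE in_set1 /=; apply/idP/imsetP => [/andP[/andP[pK /eqP ->] jp]|[l + [-> ->]]].
  by exists p; rewrite // inE pK.
by rewrite inE eqxx andbT.
Qed.

Lemma above_D1 (K : {set 'I_m}) i j : i \in K -> above K j = ((j < i)%N + above (K :\ i) j)%N.
Proof.
move=> iK; rewrite /above (cardsD1 i) inE iK /=; congr (_ + _)%N.
by apply: eq_card => l; rewrite !inE andbA.
Qed.

(** Interchanging the two removed indices changes the total inversion count by exactly one. *)
Lemma rwedge_anticomm u v w K : rwedge u (rwedge v w) K = - rwedge v (rwedge u w) K.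
Proof.
pose F u v i j := (-1) ^+ above (K :\ j) j * ((-1) ^+ above (K :\ j :\ i) i *
   w (K :\ j :\ i) * v i) * u j.
have E u' v' : rwedge u' (rwedge v' w) K =
    \sum_(j in K) \sum_(i in K | i != j) F u' v' i j.
  apply: eq_bigr => j jK; rewrite mulr_sumr mulr_suml; apply: eq_bigl => i.
  by rewrite !inE andbC.
rewrite !E -sumrN (exchange_big_dep (mem K)) /=; last by move=> ? ? _ /andP[].
apply: eq_bigr => j jK.
rewrite -sumrN; apply: eq_big => i; first by rewrite jK eq_sym.
move=> /and3P[iK _ ji]; have ij : i != j by rewrite eq_sym.
rewrite /F.
rewrite (@above_D1 (K :\ i) j i) ?inE ?jK ?ji //.
rewrite (@above_D1 (K :\ j) i j) ?inE ?iK ?ij //.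
have -> : K :\ i :\ j = K :\ j :\ i by rewrite !setDDl setUC.
have [lt|lt|/val_inj e] := ltngtP i j; last by rewrite e eqxx in ij.
  by rewrite !exprD expr0 expr1; ring.
by rewrite !exprD expr0 expr1; ring.
Qed.

Lemma rwedge_sum (J : Type) (s : seq J) (c : J -> CC) (v : J -> 'I_m -> CC) w K :
  rwedge (fun j => \sum_(q <- s) c q * v q j) w K = \sum_(q <- s) c q * rwedge (v q) w K.
Proof.
rewrite /rwedge; under [RHS]eq_bigr => q _ do rewrite mulr_sumr.
rewrite [RHS]exchange_big; apply: eq_bigr => j _ /=; rewrite mulr_sumr.
by apply: eq_bigr => q _; rewrite mulrCA.
Qed.

Lemma rwedge0 v K : rwedge v (fun=> 0) K = 0.
Proof. by apply: big1 => j _; rewrite mulr0 mul0r. Qed.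

Lemma rwedge_twice v w K : rwedge v (rwedge v w) K = 0.
Proof.
have /eqP := rwedge_anticomm v v w K; rewrite -subr_eq0 opprK -mulr2n -mulr_natl.
by rewrite mulf_eq0 (negPf (CC_natS_neq0 1)) => /eqP.
Qed.

Section Dependent.
Variables (T : eqType) (v : T -> 'I_m -> CC) (w : {set 'I_m} -> CC).

Let wedges := foldl (fun w' q => rwedge (v q) w') w.

Lemma rwedge_mem s q : q \in s -> rwedge (v q) (wedges s) = fun=> 0.
Proof.
elim/last_ind: s => // s p IH; rewrite mem_rcons inE /wedges -cats1 foldl_cat /= -/wedges.
case/predU1P=> [<-|/IH qs]; apply/funext => K; first exact: rwedge_twice.
by rewrite rwedge_anticomm qs rwedge0 oppr0.
Qed.

(** If the last coefficient is nonzero, the last covector is a combination of earlier ones, each of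
    which kills the product; otherwise the relation already holds on the shorter list. *)
Lemma rwedge_dependent s (c : T -> CC) :
  (forall j, \sum_(q <- s) c q * v q j = 0) -> (exists2 q, q \in s & c q != 0) ->
  wedges s = fun=> 0.
Proof.
elim/last_ind: s => [|s p IH] hc [q]; first by rewrite in_nil.
rewrite mem_rcons inE /wedges -cats1 foldl_cat /= -/wedges.
have {}hc j : \sum_(q <- s) c q * v q j = - (c p * v p j).
  by apply/eqP; rewrite -addr_eq0; have := hc j; rewrite -cats1 big_cat big_seq1 /= => ->.
have [cp0|cp0] := eqVneq (c p) 0 => qs cq.
  rewrite IH; first by apply/funext => K; apply: rwedge0.
    by move=> j; rewrite hc cp0 mul0r oppr0.
  by exists q => //; case/predU1P: qs cq => // ->; rewrite cp0 eqxx.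
have -> : v p = fun j => \sum_(q <- s) (- (c q / c p)) * v q j.
  apply/funext => j; under eq_bigr => l _ do rewrite mulNr mulrAC.
  by rewrite sumrN -mulr_suml hc mulNr opprK mulrAC mulfV // mul1r.
apply/funext => K; rewrite rwedge_sum big_seq big1 // => l ls.
by rewrite rwedge_mem // mulr0.
Qed.

End Dependent.

(** A rank drop is a linear relation among the covectors dD_i at [x]. *)
Lemma wedge_dD_eval k (x : point m) (w : dform m) (D : 'I_k -> Cpoly m) K :
  ~~ row_free (jacobian_at x D) -> (wedge_dD w D K).@[x] = 0.
Proof.
move=> Jx; pose v i j := jacobian_at x D i j.
have -> : (wedge_dD w D K).@[x] =
    foldl (fun w' i => rwedge (v i) w') (fun L => (w L).@[x]) (enum 'I_k) K.
  rewrite /wedge_dD; elim: (enum 'I_k) w => //= i t IH w; rewrite IH.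
  congr (foldl _ _ _ _); apply/funext => L; rewrite eval_wedge_dpoly; congr rwedge.
  by apply/funext => j; rewrite /v mxE.
have /rowV0Pn[c /sub_kermxP cJ c0] : kermx (jacobian_at x D) != 0 by rewrite kermx_eq0.
rewrite (@rwedge_dependent _ v _ _ (fun i => c 0 i)) // => [j|].
  by have /matrixP/(_ 0 j) := cJ; rewrite !mxE big_enum.
have [i ci] : exists i, c 0 i != 0.
  apply: contrapT => h; case/negP: c0; apply/eqP/rowP => i; rewrite mxE.
  by apply/eqP; apply: contrapT => /negP ci; apply: h; exists i.
by exists i; rewrite ?mem_enum.
Qed.

End WedgeAtPoint.

(** * Gluing the forms coefficient by coefficient *)

Theorem theorem1 (m k n : nat) (D : 'I_k -> Cpoly m)
  (Ii : nat -> Cpoly m -> Prop)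
  (Hdec : irredundant_primary_decomposition (gen_ideal D) Ii n)
  (Hdim : forall i, (i < n)%N ->
            exists2 d : nat, (d + k = m)%N & variety_dim (zero_locus (Ii i)) d)
  (Hrad : forall i, (i.+1 < n)%N -> is_radical_ideal (ideal_sum (Jcap Ii i) (Ii i.+1))) :
  forall r : nat, (r + k + 1 = m)%N ->
  forall alpha : nat -> dform m,
    (forall i, (i < n)%N -> form_of_rank r (alpha i)) ->
    exists omega : dform m,
      form_of_rank (m - 1) omega /\
      (forall i, (i < n)%N ->
         forall K : {set 'I_m}, Ii i (omega K - wedge_dD (alpha i) D K)).
Proof.
move=> r rkm alpha alpha_r.
have idI i : (i < n)%N -> is_ideal (Ii i) by move=> ltin; case: (Hdec.2.1 i ltin).
have /choice[omega homega] (K : {set 'I_m}) : exists p, forall i, (i < n)%N ->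
    Ii i (p - wedge_dD (alpha i) D K).
  apply: (glue_mod_ideals (beta := fun i => wedge_dD (alpha i) D K)) => //.
  move=> i j ltin ltjn neij x xi xj.
  have Jx := jacobian_drops_at_crossing Hdec ltin ltjn neij xi xj.
  by rewrite !wedge_dD_eval.
(* Coefficients outside rank [m - 1] are set to zero, where those of the given wedge products vanish
   too. *)
exists (fun K : {set 'I_m} => if #|K| == (m - 1)%N then omega K else 0); split.
  by move=> K /eqP /negPf ->.
move=> i ltin K /=.
case: eqP => [_|Km]; first exact: homega.
rewrite (wedge_dD_rank D (alpha_r i ltin)) ?subrr; first exact: ideal0 (idI i ltin).
by move=> e; apply: Km; rewrite e -rkm addnK.
Qed.
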